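(* Let $n\ge 2$ and $m>n+2$. For every $\alpha\in[0,1]$ with $\alpha>\frac{1}{m-n}$, no ordinal algorithm is guaranteed to compute an $\alpha$-EFX allocation. That is, for every function $\mathcal{A}$ mapping each profile of $n$ rankings of the $m$ goods to an allocation, there exist a profile of additive valuations $(v_i)_{i\in N}$ and a profile of rankings $(\succ_i)_{i\in N}$ consistent with it such that the allocation $\mathcal{A}((\succ_i)_{i\in N})$ is not $\alpha$-EFX with respect to $(v_i)_{i\in N}$.
   Context: There is a set $N=\{1,\dots,n\}$ of $n\ge 2$ agents and a set $G$ of $m$ goods. Each agent $i$ has a valuation function $v_i:G\to\mathbb{R}_{\ge 0}$, extended additively to bundles: $v_i(X)=\sum_{g\in X}v_i(g)$ for $X\subseteq G$. An allocation is a tuple $(X_i)_{i\in N}$ of pairwise disjoint (possibly empty) bundles with $\bigcup_{i}X_i=G$. For $\alpha\in[0,1]$, an allocation is $\alpha$-EFX if for all agents $i\ne j$ with $X_j\neq\varnothing$ and every $g\in X_j$, $v_i(X_i)\ge\alpha\cdot v_i(X_j\setminus\{g\})$. A ranking (strict linear order) $\succ_i$ of $G$ is consistent with $v_i$ if $g\succ_i g'$ implies $v_i(g)\ge v_i(g')$. An ordinal algorithm receives as input only the rankings $(\succ_i)_{i\in N}$, consistent with the unknown valuations, and outputs an allocation. *)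

(* Defs.v *)
From HB Require Import structures.
From mathcomp Require Import all_boot all_order all_algebra.
From mathcomp Require Import reals.

Set Implicit Arguments.
Unset Strict Implicit.
Unset Printing Implicit Defensive.

Import Order.TTheory GRing.Theory Num.Theory.
Local Open Scope ring_scope.

(* [prefers x y] means that [x] is ranked strictly above [y]. *)
Record ranking (G : finType) := Ranking {
  prefers :> rel G;
  prefers_irr : irreflexive prefers;
  prefers_trans : transitive prefers;
  prefers_total : forall x y, x != y -> prefers x y || prefers y x
}.

(* Bundles may be empty, so disjointness is required index by index rather
   than through [partition] or [trivIset], which speak about the set of
   bundles. *)
Record allocation (n : nat) (G : finType) := Allocation {
  bundle :> 'I_n -> {set G};
  bundle_disjoint : forall i j, i != j -> [disjoint bundle i & bundle j];
  bundle_cover : \bigcup_i bundle i = [set: G]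
}.

Definition value (R : realType) (G : finType) (v : G -> R) (X : {set G}) : R :=
  \sum_(g in X) v g.

Definition EFX (R : realType) (n : nat) (G : finType) (alpha : R)
    (v : 'I_n -> G -> R) (X : allocation n G) : Prop :=
  forall i j : 'I_n, i != j -> X j != set0 ->
    forall g, g \in X j -> alpha * value (v i) (X j :\ g) <= value (v i) (X i).

Definition consistent (R : realType) (G : finType) (r : ranking G)
    (v : G -> R) : Prop :=
  forall g g', r g g' -> v g' <= v g.

Definition ordinal_algorithm (n : nat) (G : finType) : Type :=
  ('I_n -> ranking G) -> allocation n G.

(* Main.v *)
(* All agents report the same ranking and, for some k, value exactly the k top
   goods at 1.  For 0 < k < n some agent owns none of the top k goods and
   values its own bundle at 0, so the owner of the k-th good must own nothing
   else.  Hence n - 1 agents own one good each and the last agent owns the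
   other m - n + 1 goods; taking k = m then forces alpha * (m - n) <= 1. *)
Require Import Defs.
From HB Require Import structures.
From mathcomp Require Import all_boot all_order all_algebra.
From mathcomp Require Import boolp reals.

Set Implicit Arguments.
Unset Strict Implicit.
Unset Printing Implicit Defensive.

Import Order.TTheory GRing.Theory Num.Theory.
Local Open Scope ring_scope.

Section Owner.
Variables (n : nat) (G : finType) (X : allocation n G).

Lemma owner_exists g : exists i, g \in X i.
Proof.
have: g \in \bigcup_i X i by rewrite bundle_cover inE.
by case/bigcupP => i _; exists i.
Qed.

(** Encoding the allocation as a function on goods turns counting agents into bounding the size of
    an image of [owner]. *)
Definition owner g : 'I_n := xchoose (owner_exists g).

Lemma mem_bundle g i : (g \in X i) = (owner g == i).
Proof.
have Xg : g \in X (owner g) by exact: (xchooseP (owner_exists g)).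
by have [<- //|/(bundle_disjoint X) /disjointFr ->] := eqVneq (owner g) i.
Qed.

End Owner.

Section EnumRanking.
Variable G : finType.

Let above : rel G := fun x y => (enum_rank x < enum_rank y)%N.

Let above_irr : irreflexive above.
Proof. by move=> x; rewrite /above ltnn. Qed.

Let above_trans : transitive above.
Proof. by move=> y x z; apply: ltn_trans. Qed.

Let above_total x y : x != y -> above x y || above y x.
Proof. by rewrite /above -neq_ltn val_eqE (inj_eq enum_rank_inj). Qed.

Definition enum_ranking := Ranking above_irr above_trans above_total.

Definition top k : {set G} := [set g | enum_rank g < k]%N.

Lemma card_top k : (k <= #|G|)%N -> #|top k| = k.
Proof.
move=> kG; have -> : top k = enum_rank @^-1: [set i : 'I_#|G| | (i < k)%N].
  by apply/setP => g; rewrite !inE.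
rewrite on_card_preimset; last exact: onW_bij (enum_rank_bij G).
by rewrite cardsE -sum1_card -(big_ord_widen _ (fun=> 1%N) kG) sum1_card card_ord.
Qed.

Lemma top_card : top #|G| = setT.
Proof. by apply/setP => g; rewrite !inE ltn_ord. Qed.

Variable R : realType.

(** The ranking is the same for all [k], so an ordinal algorithm cannot tell these valuations
    apart. *)
Lemma consistent_top k : consistent enum_ranking (fun g => (g \in top k)%:R : R).
Proof.
move=> g g' /= gg'; rewrite ler_nat !inE.
by case: (ltnP _ k) => // g'k; rewrite (ltn_trans gg' g'k).
Qed.

End EnumRanking.

Lemma value_indicator (R : realType) (G : finType) (T B : {set G}) :
  value (fun g => (g \in T)%:R : R) B = #|B :&: T|%:R.
Proof.
rewrite /value -natr_sum -sum1_card; congr _%:R.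
rewrite big_mkcond [RHS]big_mkcond; apply: eq_bigr => g _.
by rewrite !inE; do 2!case: (g \in _).
Qed.

Section TopIndicatorEFX.
Variables (R : realType) (n : nat) (G : finType) (alpha : R).
Variable X : allocation n G.
Hypothesis alpha_gt0 : 0 < alpha.
Hypothesis nG : (n <= #|G|)%N.
Hypothesis efx : forall k, EFX alpha (fun _ g => (g \in top G k)%:R) X.

Lemma EFX_top k i j h : i != j -> h \in X j ->
  alpha * #|(X j :\ h) :&: top G k|%:R <= #|X i :&: top G k|%:R.
Proof.
move=> ij hj; have Xj0 : X j != set0 by apply/set0Pn; exists h.
by have := efx k ij Xj0 hj; rewrite !value_indicator.
Qed.

(** If [h] differed from [g], removing [h] from their common bundle would leave [g], worth 1 to an
    agent whose own bundle is worth 0. As [h] ranges over all goods, [g] is the only good of its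
    owner. *)
Lemma top_owner_inj g h : g \in top G n.-1 -> owner X h = owner X g -> h = g.
Proof.
rewrite inE => gn hg; apply/eqP/negPn/negP => neq_hg.
(* Ranks start at 0, so this is the least [k] for which [top G k] contains [g]. *)
set k := (enum_rank g).+1.
have ltkn : (k < n)%N by rewrite /k -ltn_predRL.
have kG : (k <= #|G|)%N by exact: ltn_ord.
(* Pigeonhole: [k < n] goods have at most [k] owners. *)
have [i iS] : exists i, i \notin owner X @: top G k.
  apply/existsP; rewrite -negb_forall; apply/negP => /forallP allS.
  have := leq_imset_card (owner X) (mem (top G k)).
  rewrite card_top // leqNgt => /negP; apply.
  by rewrite (eq_card (B := predT)) ?card_ord // => j; rewrite allS.
have gk : g \in top G k by rewrite inE.
have ij : i != owner X g.
  by apply: contraNneq iS => ->; apply: imset_f.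
have := @EFX_top k i (owner X g) h ij; rewrite mem_bundle hg eqxx => /(_ isT).
have -> : X i :&: top G k = set0.
  apply/setP => x; rewrite !inE mem_bundle; apply/negbTE/negP => /andP[/eqP xi xk].
  by rewrite -xi imset_f ?inE in iS.
rewrite cards0 leNgt mulr_gt0 // ltr0n card_gt0; apply/set0Pn; exists g.
by rewrite in_setI gk !inE mem_bundle eqxx eq_sym neq_hg.
Qed.

Lemma EFX_top_bound : (1 < n)%N -> alpha * (#|G| - n)%:R <= 1.
Proof.
move=> n_gt1; have n_gt0 := ltnW n_gt1; set S := owner X @: top G n.-1.
have nG1 : (n.-1 <= #|G|)%N := leq_trans (leq_pred n) nG.
have cardS : #|S| = n.-1.
  by rewrite card_in_imset ?card_top // => x y xT yT; apply: top_owner_inj.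
(* The [n.-1] top goods have distinct owners, so exactly one agent [l] is left over. *)
have /cards1P[l Sl] : #|~: S| == 1%N.
  by rewrite cardsCs setCK cardS card_ord -[X in (X - _)%N](prednK n_gt0) subSnn.
(* An owner in [S] already holds a top good and hence nothing else, so every remaining good falls to
   [l]. *)
have rest_l : ~: top G n.-1 \subset X l.
  apply/subsetP => x; rewrite inE => xT; rewrite mem_bundle.
  rewrite -in_set1 -Sl inE.
  by apply: contra xT => /imsetP[y yT /(top_owner_inj yT) ->].
have card_l : (#|G| - n < #|X l|)%N.
  apply: leq_trans (subset_leq_card rest_l).
  by rewrite cardsCs setCK card_top // -subSn // -{1}(prednK n_gt0) subSS.
(* Here [1 < n] provides an agent other than [l] to do the comparing. *)
have [g gT] : exists g, g \in top G n.-1.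
  by apply/set0Pn; rewrite -card_gt0 card_top // ltn_predRL.
have neq_l : owner X g != l.
  by rewrite -in_set1 -Sl inE negbK imset_f.
have [h hl] : exists h, h \in X l.
  by apply/set0Pn; rewrite -card_gt0 (leq_ltn_trans _ card_l).
(* With [k = #|G|] every good is worth 1 and values are cardinalities. *)
have := EFX_top #|G| neq_l hl; rewrite top_card !setIT => efx_gl.
have single : (#|X (owner X g)| <= 1)%N.
  rewrite -(cards1 g); apply/subset_leq_card/subsetP => x.
  by rewrite mem_bundle inE => /eqP /(top_owner_inj gT) ->.
apply: le_trans (_ : #|X (owner X g)|%:R <= 1); last by rewrite lern1.
(* The strict bound [card_l] absorbs the removed good [h]. *)
apply: le_trans efx_gl; rewrite ler_pM2l // ler_nat -ltnS.
by have := cardsD1 h (X l); rewrite hl add1n => <-.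
Qed.

End TopIndicatorEFX.

Theorem theorem2p2 (R : realType) (n m : nat) (G : finType)
    (hn : (2 <= n)%N) (hG : #|G| = m) (hm : (n + 2 < m)%N)
    (alpha : R) (halpha0 : 0 <= alpha) (halpha1 : alpha <= 1)
    (halpha : 1 / (m%:R - n%:R) < alpha)
    (A : ordinal_algorithm n G) :
  exists (v : 'I_n -> G -> R) (r : 'I_n -> ranking G),
    [/\ forall i g, 0 <= v i g,
        forall i, consistent (r i) (v i)
      & ~ EFX alpha v (A r)].
Proof.
have nm : (n < m)%N by apply: leq_ltn_trans hm; apply: leq_addr.
have mn_gt0 : 0 < m%:R - n%:R :> R by rewrite subr_gt0 ltr_nat.
have alpha_gt0 : 0 < alpha by apply: lt_trans halpha; rewrite divr_gt0.
pose r (_ : 'I_n) := enum_ranking G.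
(* Negating the goal makes the single allocation [A r] EFX for all [k] at once, so different values
   of [k] can be combined. *)
apply: contrapT => noA.
have efx k : EFX alpha (fun _ g => (g \in top G k)%:R) (A r).
  apply: contrapT => nefx; apply: noA.
  exists (fun _ g => (g \in top G k)%:R), r; split => // i.
  exact: consistent_top.
have nG : (n <= #|G|)%N by rewrite hG ltnW.
have := EFX_top_bound alpha_gt0 nG efx hn.
by rewrite hG natrB ?(ltnW nm) // leNgt -ltr_pdivrMr // halpha.
Qed.
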